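(* Let $n \geq 1$ be an integer and consider the Build Up 1-2-3 game on $n$. If $n = 4$ or $n$ is odd, Player 1 has a winning strategy; if $n$ is even and $n \neq 4$, Player 2 has a winning strategy.
   Context: Fibonacci numbers are indexed $F_1=1$, $F_2=2$, $F_3 = 3$, $F_{k+1}=F_k+F_{k-1}$. Reversed Zeckendorf game from a given position: a position is a multiset of Fibonacci numbers (''chips''), with $h_k$ the number of chips equal to $F_k$; two players alternate moves; legal moves are: (Split) for $k \geq 3$, if $h_k \geq 1$, replace one chip $F_k$ by chips $F_{k-1}$ and $F_{k-2}$; if $h_2 \geq 1$, replace one chip $F_2$ by two chips $F_1$. (Combine) for $k > 2$, if $h_{k-2}\ge1$ and $h_{k+1} \geq 1$, replace one chip $F_{k-2}$ and one chip $F_{k+1}$ by two chips $F_k$; if $h_1 \geq 1$ and $h_3 \geq 1$, replace one chip $F_1$ and one chip $F_3$ by two chips $F_2$. A player who cannot move loses. Build Up 1-2-3 game on $n$: Players 1 and 2 alternately (Player 1 first) put down a number $1$, $2$ or $3$, with the running total of all numbers put down never exceeding $n$, until the total equals exactly $n$. This yields a position with $a$ ones, $b$ twos and $c$ threes. The players then play the reversed Zeckendorf game from this position, with the first move made by the player who did not put down the last number. The winner of this reversed Zeckendorf game wins the Build Up game. *)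

(* Defs.v *)
From mathcomp Require Import all_boot finmap multiset.

Set Implicit Arguments.
Unset Strict Implicit.
Unset Printing Implicit Defensive.

Local Open Scope mset_scope.
Local Open Scope nat_scope.

(* F_1 = 1, F_2 = 2, F_3 = 3, F_4 = 5, ...  The value at 0 is a filler that no
   rule of the game refers to. *)
Fixpoint F (k : nat) : nat :=
  match k with
  | 0 => 1
  | 1 => 1
  | (k'.+1 as k1).+1 => F k1 + F k'
  end.

(* The elements of a position are the values of the chips, not their
   Fibonacci indices. *)
Definition position := {mset nat}.

Definition h (p : position) (k : nat) : nat := p (F k).

Definition exchange (p old new : position) : position := (p `\` old) `+` new.

Inductive rz_move (p : position) : position -> Prop :=
| Split k : 3 <= k -> 1 <= h p k ->
    rz_move p (exchange p [mset F k] ([mset F (k - 1)] `+` [mset F (k - 2)]))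
| Split2 : 1 <= h p 2 ->
    rz_move p (exchange p [mset F 2] (msetn 2 (F 1)))
| Combine k : 2 < k -> 1 <= h p (k - 2) -> 1 <= h p (k + 1) ->
    rz_move p
      (exchange p ([mset F (k - 2)] `+` [mset F (k + 1)]) (msetn 2 (F k)))
| Combine13 : 1 <= h p 1 -> 1 <= h p 3 ->
    rz_move p (exchange p ([mset F 1] `+` [mset F 3]) (msetn 2 (F 2))).

(* [Building s]: the numbers put down so far are s, most recent first. *)
Variant bu_state : Type :=
| Building of seq nat
| Reversing of position.

(* Whoever puts down the last number has just moved, so strict alternation
   gives the first move of the reversed game to the other player. *)
Inductive bu_move (n : nat) : bu_state -> bu_state -> Prop :=
| Put s x : x \in [:: 1; 2; 3] -> sumn (x :: s) < n ->
    bu_move n (Building s) (Building (x :: s))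
| PutLast s x : x \in [:: 1; 2; 3] -> sumn (x :: s) = n ->
    bu_move n (Building s) (Reversing (seq_mset (x :: s)))
| Reverse p q : rz_move p q ->
    bu_move n (Reversing p) (Reversing q).

Variant player : Type := Player1 | Player2.

(* Two players move alternately from [init], Player 1 first, and a player who
   cannot move loses.  A history lists all states visited so far, most recent
   first and including [init]. *)
Section AlternatingGame.

Variables (T : Type) (init : T) (move : T -> T -> Prop).

Definition to_move (hist : seq T) : player :=
  if odd (size hist) then Player1 else Player2.

Definition stuck (s : T) : Prop := forall t, ~ move s t.

Definition strategy : Type := seq T -> T.

(* Histories that can arise when player P plays according to sigma and the
   opponent plays arbitrary legal moves. *)
Inductive follows (P : player) (sigma : strategy) : seq T -> Prop :=
| FollowsInit : follows P sigma [:: init]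
| FollowsOwn s hist : follows P sigma (s :: hist) ->
    to_move (s :: hist) = P -> move s (sigma (s :: hist)) ->
    follows P sigma (sigma (s :: hist) :: s :: hist)
| FollowsOpp s hist t : follows P sigma (s :: hist) ->
    to_move (s :: hist) <> P -> move s t ->
    follows P sigma (t :: s :: hist).

(* The strategy always prescribes a legal move if there is one, no play
   following it is infinite, and in each one that ends the player left without
   a move is the opponent. *)
Definition winning_strategy (P : player) (sigma : strategy) : Prop :=
  [/\ forall s hist, follows P sigma (s :: hist) ->
        to_move (s :: hist) = P -> ~ stuck s -> move s (sigma (s :: hist)),
      forall f : nat -> T, ~ (forall i, follows P sigma (rev (mkseq f i.+1)))
    & forall s hist, follows P sigma (s :: hist) -> stuck s ->
        to_move (s :: hist) <> P].

Definition has_winning_strategy (P : player) : Prop :=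
  exists sigma : strategy, winning_strategy P sigma.

End AlternatingGame.

Definition build_up_123_winner (n : nat) (P : player) : Prop :=
  has_winning_strategy (Building [::]) (bu_move n) P.

(* Main.v *)
(** From a position with [a] ones, [b] twos and [c] threes, the reversed game
    never creates a chip larger than 3, and the player to move loses exactly
    when [b] is even and either [c] is odd, [a] is even and [a < c], or [c] is
    even and it is not the case that [a] is odd and [a < c].  Feeding this into
    the build-up phase by backward induction on the amount [r] still to be put
    down, the dependence on [a] and [c] vanishes as soon as [5 <= r]: the
    player to move then loses exactly when [b] and [r] have the same parity.
    With [b = 0] and [r = n] this settles [5 <= n]; smaller [n] are computed. *)

Require Import Defs.
From mathcomp Require Import all_boot.
From mathcomp Require Import finmap multiset zify.
From Stdlib Require Import ClassicalEpsilon.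

Set Implicit Arguments.
Unset Strict Implicit.
Unset Printing Implicit Defensive.

(** * Strategies from a kernel of lost states *)

Section Kernel.

Variables (T : Type) (init : T) (move : T -> T -> Prop).
Variables (inv : T -> Prop) (mu : T -> nat) (lost : T -> bool).

Hypothesis inv_init : inv init.
Hypothesis inv_move : forall s t, inv s -> move s t -> inv t.
Hypothesis mu_move : forall s t, inv s -> move s t -> mu t < mu s.
Hypothesis lost_move : forall s t, inv s -> move s t -> lost s -> ~~ lost t.
Hypothesis not_lost_move :
  forall s, inv s -> ~~ lost s -> exists t, move s t /\ lost t.

(** Only the latest state matters. From a lost state [epsilon] returns an arbitrary value, which is
    harmless because the winning player never has to move there. *)
Definition kernel_strategy : strategy T := fun hist =>
  if hist is s :: _
  then epsilon (inhabits init) (fun t => move s t /\ lost t) else init.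

Lemma kernel_strategyP s hist : inv s -> ~~ lost s ->
  move s (kernel_strategy (s :: hist)) /\ lost (kernel_strategy (s :: hist)).
Proof.
move=> Is nls.
exact: (epsilon_spec (inhabits init) (fun t => move s t /\ lost t)
  (not_lost_move Is nls)).
Qed.

Lemma to_move_cons (t : T) hist P :
  to_move (t :: hist) = P <-> to_move hist <> P.
Proof. by rewrite /to_move /=; case: (odd _); case: P. Qed.

(** Own moves lead from non-lost to lost states and opposing moves lead back, so lostness stays in
    step with the turn throughout the play. *)
Lemma follows_kernel P s hist :
  (P = Player1 <-> ~~ lost init) ->
  follows init move P kernel_strategy (s :: hist) ->
  inv s /\ (to_move (s :: hist) = P <-> ~~ lost s).
Proof.
move=> P_init; move E: (s :: hist) => l fol.
elim: fol s hist E => [|s l0 _ IH own mv|s l0 t _ IH opp mv] s' hist [-> _].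
- by split=> //; rewrite -P_init /to_move /=; split.
- have [Is sP] := IH _ _ erefl.
  have [_ lt] := kernel_strategyP l0 Is (proj1 sP own).
  split; first exact: inv_move mv.
  by rewrite to_move_cons lt; split.
- have [Is sP] := IH _ _ erefl.
  split; first exact: inv_move mv.
  rewrite to_move_cons; split=> // _.
  apply: (lost_move Is mv); apply/negPn/negP => nls.
  exact: opp (proj2 sP nls).
Qed.

Lemma follows_last_move P sigma t s hist :
  follows init move P sigma (t :: s :: hist) -> move s t.
Proof.
move E: (t :: s :: hist) => l fol.
by case: fol E => // ? ? => [_ ? ?|? _ _ ?] [-> -> _].
Qed.

Lemma kernel_has_winning_strategy P :
  (P = Player1 <-> ~~ lost init) -> has_winning_strategy init move P.
Proof.
move=> P_init; exists kernel_strategy; split.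
- move=> s hist fol own _; have [Is sP] := follows_kernel P_init fol.
  by case: (kernel_strategyP hist Is (proj1 sP own)).
- move=> f fol.
  have dec i : mu (f i.+1) < mu (f i).
    have := fol i.+1; have := fol i; rewrite !mkseqS !rev_rcons => foli folSi.
    have [Ii _] := follows_kernel P_init foli.
    exact: mu_move Ii (follows_last_move folSi).
  (* An infinite play would make [mu] drop at each step, which is absurd after [(mu (f 0)).+1]
     steps. *)
  have bound i : mu (f i) + i <= mu (f 0).
    by elim: i => [|i IH]; [rewrite addn0 | have := dec i; lia].
  by have := bound (mu (f 0)).+1; lia.
- move=> s hist fol st own; have [Is sP] := follows_kernel P_init fol.
  have [t [mv _]] := not_lost_move Is (proj1 sP own).
  exact: st mv.
Qed.

End Kernel.

(** * The reversed game on ones, twos and threes *)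

Definition rz_lost (a b c : nat) : bool :=
  ~~ odd b &&
  (if odd c then ~~ odd a && (a < c) else ~~ odd a || (c <= a)).

Definition small (p : position) : Prop := forall x, 3 < x -> p x = 0.

Lemma F_gt3 k : 4 <= k -> 3 < F k.
Proof.
case: k => [|[|[|[|k]]]] // _.
by elim: k => // k IH; apply: leq_trans IH _; apply: leq_addr.
Qed.

Variant count_move (a b c : nat) : nat -> nat -> nat -> Prop :=
| CountSplit3 of 0 < c : count_move a b c a.+1 b.+1 c.-1
| CountSplit2 of 0 < b : count_move a b c a.+2 b.-1 c
| CountCombine of 0 < a & 0 < c : count_move a b c a.-1 b.+2 c.-1.

(** A three weighs 3 because combining trades it, together with a one, for two twos: the weight must
    exceed 2. *)
Lemma count_move_lt a b c a' b' c' :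
  count_move a b c a' b' c' -> b' + 3 * c' < b + 3 * c.
Proof. by case; lia. Qed.

Lemma exchangeE (p old new : position) x :
  (exchange p old new) x = p x - old x + new x.
Proof. by rewrite /exchange !msetE2. Qed.

Lemma rz_move_count p q : small p -> rz_move p q ->
  small q /\ count_move (p 1) (p 2) (p 3) (q 1) (q 2) (q 3).
Proof.
move=> sp mv.
have big k : 4 <= k -> h p k = 0 by move=> /F_gt3/sp.
have neq x y : 3 < x -> y <= 3 -> (x == y) = false by lia.
case: mv => [k k3 hk|h2|k k2 _ hk|h1 h3].
(* A split with [4 <= k] would need a chip larger than 3. *)
- have {}k3 : k = 3.
    by apply/eqP; rewrite eqn_leq k3 andbT leqNgt; apply/negP => /big; lia.
  subst k; split=> [x x3|].
    by rewrite exchangeE sp // !(msetE2, msetnE) !neq.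
  rewrite !exchangeE !(msetE2, msetnE) /= !addn0 ?subn0 !addn1 subn1.
  by constructor.
- split=> [x x3|]; first by rewrite exchangeE sp // !msetnE !neq.
  rewrite !exchangeE !msetnE /= !addn0 ?subn0 !addn2 subn1.
  by constructor.
(* This move consumes a chip [F (k + 1)] with [4 <= k + 1], and there is none. *)
- by move: hk; rewrite big //; lia.
- split=> [x x3|]; first by rewrite exchangeE sp // !(msetE2, msetnE) !neq.
  rewrite !exchangeE !(msetE2, msetnE) /= !addn0 ?subn0 !addn2 !subn1.
  by constructor.
Qed.

Lemma count_rz_move (p : position) a b c : count_move (p 1) (p 2) (p 3) a b c ->
  exists q, [/\ rz_move p q, q 1 = a, q 2 = b & q 3 = c].
Proof.
case=> [h3|h2|h1 h3].
- refine (ex_intro _ _ (And4 (@Defs.Split p 3 isT h3) _ _ _));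
    rewrite exchangeE !(msetE2, msetnE) /=; lia.
- refine (ex_intro _ _ (And4 (@Split2 p h2) _ _ _));
    rewrite exchangeE !msetnE /=; lia.
- refine (ex_intro _ _ (And4 (@Combine13 p h1 h3) _ _ _));
    rewrite exchangeE !(msetE2, msetnE) /=; lia.
Qed.

(** Once the parity of every variable is fixed, only linear comparisons remain. *)
Ltac parity_lia :=
  rewrite /=;
  repeat match goal with
  | |- context [odd ?x] => is_var x; case: (boolP (odd x)) => /= ?
  end; lia.

Lemma count_move_lost a b c a' b' c' : count_move a b c a' b' c' ->
  rz_lost a b c -> ~~ rz_lost a' b' c'.
Proof.
rewrite /rz_lost.
by case; case: a b c => [|a] [|b] [|c] //=; parity_lia.
Qed.

Lemma count_move_not_lost a b c : ~~ rz_lost a b c ->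
  exists a' b' c', count_move a b c a' b' c' /\ rz_lost a' b' c'.
Proof.
move=> nl.
have [/andP[c0 l]|n3] := boolP ((0 < c) && rz_lost a.+1 b.+1 c.-1).
  by exists a.+1, b.+1, c.-1; split=> //; constructor.
have [/andP[b0 l]|n2] := boolP ((0 < b) && rz_lost a.+2 b.-1 c).
  by exists a.+2, b.-1, c; split=> //; constructor.
have [/and3P[a0 c0 l]|n1] := boolP [&& 0 < a, 0 < c & rz_lost a.-1 b.+2 c.-1].
  by exists a.-1, b.+2, c.-1; split=> //; constructor.
(* If none of the three moves reaches a lost position, the parities and the comparison of [a] with
   [c] contradict [nl]. *)
exfalso; move: nl n3 n2 n1; rewrite /rz_lost.
by case: a b c => [|a] [|b] [|c] //=; parity_lia.
Qed.

(** * The build-up phase *)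

(* [r] is the amount still to be put down. *)
Fixpoint build_lost (r a b c : nat) : bool :=
  match r with
  | 0 => rz_lost a b c
  | r1.+1 => ~~ (build_lost r1 a.+1 b c ||
     match r1 with
     | 0 => false
     | r2.+1 => build_lost r2 a b.+1 c ||
       match r2 with 0 => false | r3.+1 => build_lost r3 a b c.+1 end
     end)
  end.

Lemma build_lostSSS r a b c : build_lost r.+3 a b c =
  ~~ [|| build_lost r.+2 a.+1 b c, build_lost r.+1 a b.+1 c
       | build_lost r a b c.+1].
Proof. by []. Qed.

(** The closed forms at 2, 3 and 4 are the values below 5 to which 5, 6 and 7 refer back. *)
Lemma build_lost2 a b c : build_lost 2 a b c =
  ~~ odd b &&
  (if odd c then ~~ odd a && (a.+1 < c) else ~~ odd a || (c <= a.+1)).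
Proof. by rewrite /= /rz_lost /=; parity_lia. Qed.

Lemma build_lost3 a b c : build_lost 3 a b c =
  odd b && (if odd c then odd a && (a < c) else odd a || (c <= a)).
Proof.
by rewrite build_lostSSS build_lost2 /= /rz_lost /=; parity_lia.
Qed.

Lemma build_lost4 a b c : build_lost 4 a b c =
  ~~ odd b && (if odd c then odd a || (c <= a) else odd a && (a < c)).
Proof.
rewrite build_lostSSS build_lost3 build_lost2 /= /rz_lost /=.
by parity_lia.
Qed.

(** Each number put down flips the parity of [b + r]: 1 and 3 through [r], 2 through [b]. From 8 on
    all three options fall under the induction hypothesis; at 5, 6 and 7 the closed forms enter. *)
Lemma build_lost_ge5 r a b c : 5 <= r -> build_lost r a b c = (odd b == odd r).
Proof.
elim/ltn_ind: r a b c => -[|[|[|[|[|[|[|[|r]]]]]]]] // IH a b c _.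
- rewrite build_lostSSS build_lost4 build_lost3 build_lost2 /=.
  by parity_lia.
- rewrite build_lostSSS IH // build_lost4 build_lost3 /=.
  by parity_lia.
- rewrite build_lostSSS IH // IH // build_lost4 /=.
  by parity_lia.
- by rewrite build_lostSSS !IH; [parity_lia | lia..].
Qed.

Definition build_lost_seq (n : nat) (s : seq nat) : bool :=
  build_lost (n - sumn s) (count_mem 1 s) (count_mem 2 s) (count_mem 3 s).

Lemma build_lost_seqN n s : sumn s < n ->
  ~~ build_lost_seq n s =
  has (fun x => (sumn (x :: s) <= n) && build_lost_seq n (x :: s)) [:: 1; 2; 3].
Proof.
move=> ltn; rewrite /build_lost_seq /=.
have [r Er] : exists r, n - sumn s = r.+1 by exists (n - sumn s).-1; lia.
have sub k : n - (k + sumn s) = r.+1 - k by lia.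
have le k : (k + sumn s <= n) = (k <= r.+1) by lia.
rewrite !sub !le Er !add0n !add1n !subSS subn0 orbF /= negbK.
by case: r {Er sub le} => [|[|r]] //=; rewrite ?subSS ?orbF ?subn0.
Qed.

Lemma small_seq_mset s : all (fun x => x <= 3) s -> small (seq_mset s).
Proof.
move=> /allP s3 x x3; rewrite mset_seqE.
by apply/count_memPn/negP => /s3; lia.
Qed.

Lemma count_sumn_le s : count_mem 2 s + 3 * count_mem 3 s <= sumn s.
Proof. by elim: s => [|[|[|[|[|x]]]] s] //=; lia. Qed.

(** * Invariant, measure and lost states across both phases *)

Section BuildUp.

Variable n : nat.

Definition bu_inv (st : bu_state) : Prop :=
  match st with
  | Building s => all (fun x => x <= 3) s /\ sumn s < n
  | Reversing p => small p
  end.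

(** The extra [n] keeps building states above the hand-over, where by [count_sumn_le] the reversed
    measure is at most [n]. *)
Definition bu_mu (st : bu_state) : nat :=
  match st with
  | Building s => n + (n - sumn s)
  | Reversing p => p 2 + 3 * p 3
  end.

Definition bu_lost (st : bu_state) : bool :=
  match st with
  | Building s => build_lost_seq n s
  | Reversing p => rz_lost (p 1) (p 2) (p 3)
  end.

Lemma bu_lost_full s : sumn s = n ->
  bu_lost (Reversing (seq_mset s)) = build_lost_seq n s.
Proof. by move=> sn; rewrite /= /build_lost_seq sn subnn !mset_seqE. Qed.

Lemma bu_inv_move st st' : bu_inv st -> bu_move n st st' -> bu_inv st'.
Proof.
move=> I mv; case: mv I => [s x x123 lt|s x x123 e|p q mv] /=.
- by case=> s3 _; rewrite s3 andbT; split=> //; move: x123; rewrite !inE; lia.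
- case=> s3 _; apply: small_seq_mset => /=; rewrite s3 andbT.
  by move: x123; rewrite !inE; lia.
- by move=> sp; case: (rz_move_count sp mv).
Qed.

Lemma bu_mu_move st st' : bu_inv st -> bu_move n st st' -> bu_mu st' < bu_mu st.
Proof.
move=> I mv; case: mv I => [s x x123 lt|s x x123 e|p q mv] /=.
- by case=> _ ltn; move: x123 lt; rewrite !inE /=; lia.
- case=> _ ltn; rewrite !mset_seqE.
  by apply: leq_ltn_trans (count_sumn_le (x :: s)) _; rewrite e; lia.
- by move=> sp; case: (rz_move_count sp mv) => _ /count_move_lt.
Qed.

Lemma bu_lost_move st st' :
  bu_inv st -> bu_move n st st' -> bu_lost st -> ~~ bu_lost st'.
Proof.
have put s x : sumn s < n -> x \in [:: 1; 2; 3] -> sumn (x :: s) <= n ->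
    build_lost_seq n s -> ~~ build_lost_seq n (x :: s).
  move=> ltn x123 le; apply: contraLR; rewrite negbK build_lost_seqN // => l.
  by apply/hasP; exists x => //; rewrite le.
move=> I mv; case: mv I => [s x x123 lt|s x x123 e|p q mv].
- by case=> _ ltn; apply: put => //; apply: ltnW.
- by case=> _ ltn; rewrite bu_lost_full //; apply: put; rewrite ?e.
- by move=> sp; case: (rz_move_count sp mv) => _ /count_move_lost.
Qed.

Lemma bu_not_lost_move st : bu_inv st -> ~~ bu_lost st ->
  exists st', bu_move n st st' /\ bu_lost st'.
Proof.
case: st => [s|p] /= => [[_ ltn]|_].
  rewrite build_lost_seqN // => /hasP[x x123 /andP[]].
  rewrite leq_eqVlt => /orP[/eqP e|lt] l.
    exists (Reversing (seq_mset (x :: s))).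
    by rewrite bu_lost_full //; split=> //; constructor.
  by exists (Building (x :: s)); split=> //; constructor.
move=> /count_move_not_lost[a [b [c [/count_rz_move[q [mv <- <- <-]] l]]]].
by exists (Reversing q); split=> //; constructor.
Qed.

Lemma build_up_123_winnerP P : 1 <= n ->
  (P = Player1 <-> ~~ build_lost n 0 0 0) -> build_up_123_winner n P.
Proof.
(* Written with [n - 0], the condition is convertible to one about [bu_lost] of the empty
   sequence. *)
move=> hn; rewrite -{1}[n]subn0 => HP.
exact: (kernel_has_winning_strategy (conj isT hn : bu_inv (Building [::]))
  bu_inv_move bu_mu_move bu_lost_move bu_not_lost_move HP).
Qed.

End BuildUp.

Theorem theorem5p1 (n : nat) (hn : 1 <= n) :
  (n = 4 \/ odd n -> build_up_123_winner n Player1) /\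
  (~~ odd n /\ n <> 4 -> build_up_123_winner n Player2).
Proof.
have lostE : build_lost n 0 0 0 = ~~ odd n && (n != 4).
  case: n hn => [|[|[|[|[|n]]]]] // _.
  by rewrite build_lost_ge5 // andbT; case: (odd n.+1.+4).
split=> [n1|[n2 n4]]; apply: build_up_123_winnerP => //; rewrite lostE.
  by case: n1 => [->|->].
by rewrite n2; move/eqP: n4 => ->.
Qed.
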